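(* $\operatorname{achr}(K_6\square K_4)\ge 12$, $\operatorname{achr}(K_6\square K_6)\ge 18$ and $\operatorname{achr}(K_6\square K_8)\ge 21$.
   Context: For a finite simple graph $G$ and a finite set of colours $C$, a vertex colouring $f:V(G)\to C$ is complete if for every pair of distinct colours $c_1,c_2\in C$ there is an edge $v_1v_2$ of $G$ with $f(v_i)=c_i$, $i=1,2$. The achromatic number $\operatorname{achr}(G)$ is the maximum number of colours in a proper complete vertex colouring of $G$. $K_p\square K_q$ denotes the Cartesian product of complete graphs: vertex set $[1,p]\times[1,q]$, with $(i_1,j_1)$ adjacent to $(i_2,j_2)$ iff either $i_1=i_2$ and $j_1\ne j_2$, or $i_1\ne i_2$ and $j_1=j_2$. *)

(* Defs.v *)
From mathcomp Require Import all_boot.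

Set Implicit Arguments.
Unset Strict Implicit.
Unset Printing Implicit Defensive.

Record sgraph := SGraph {
  vertex :> finType;
  adj : rel vertex;
  adj_sym : symmetric adj;
  adj_irr : irreflexive adj
}.

Section Colourings.
Variables (G : sgraph) (C : finType).
Implicit Type f : G -> C.

Definition proper_colouring f : bool :=
  [forall u : G, forall v : G, adj u v ==> (f u != f v)].

Definition complete_colouring f : bool :=
  [forall c1 : C, forall c2 : C, (c1 != c2) ==>
    [exists v1 : G, exists v2 : G,
       [&& adj v1 v2, f v1 == c1 & f v2 == c2]]].

Definition achr_colouring f : bool :=
  proper_colouring f && complete_colouring f.

End Colourings.

(* A complete colouring of a nonempty graph uses every colour, so the bound
   k <= #|G| excludes nothing: see [achr_max] and [achr_attained]. *)
Definition achr (G : sgraph) : nat :=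
  \max_(k < #|G|.+1 | [exists f : {ffun G -> 'I_k}, achr_colouring f]) k.

Section Complete.
Variable n : nat.

Definition K_adj : rel 'I_n := fun i j => i != j.

Lemma K_adj_sym : symmetric K_adj.
Proof. by move=> i j; rewrite /K_adj eq_sym. Qed.

Lemma K_adj_irr : irreflexive K_adj.
Proof. by move=> i; rewrite /K_adj eqxx. Qed.

Definition K : sgraph := SGraph K_adj_sym K_adj_irr.

End Complete.

Section CartesianProduct.
Variables G H : sgraph.

Definition cart_adj : rel (G * H)%type := fun u v =>
  ((u.1 == v.1) && adj u.2 v.2) || (adj u.1 v.1 && (u.2 == v.2)).

Lemma cart_adj_sym : symmetric cart_adj.
Proof.
move=> u v; rewrite /cart_adj (eq_sym u.1) (eq_sym u.2).
by rewrite (adj_sym u.1) (adj_sym u.2).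
Qed.

Lemma cart_adj_irr : irreflexive cart_adj.
Proof. by move=> u; rewrite /cart_adj !adj_irr andbF. Qed.

Definition cart : sgraph := SGraph cart_adj_sym cart_adj_irr.

End CartesianProduct.

Lemma complete_card (G : sgraph) (C : finType) (f : G -> C) :
  0 < #|G| -> complete_colouring f -> #|C| <= #|G|.
Proof.
move=> G0 cf.
have [C1|C1] := leqP #|C| 1; first exact: leq_trans C1 G0.
apply: leq_trans (leq_image_card f G); apply/subset_leq_card/subsetP => c _.
have [c' c'Nc] : exists c', c' != c.
  apply/existsP; apply: contraLR C1; rewrite negb_exists => /forallP E.
  rewrite -leqNgt -(card1 c); apply/subset_leq_card/subsetP => d _.
  by move: (E d); rewrite negbK inE.
move/forallP/(_ c)/forallP/(_ c'): cf; rewrite eq_sym c'Nc /=.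
case/existsP=> v /existsP[w /and3P[_ /eqP <- _]].
exact: image_f.
Qed.

Lemma achr_max (G : sgraph) (C : finType) (f : G -> C) :
  0 < #|G| -> achr_colouring f -> #|C| <= achr G.
Proof.
move=> G0 /andP[pf cf].
have ltC : #|C| < #|G|.+1 by rewrite ltnS (complete_card G0 cf).
pose F := fun k : 'I_#|G|.+1 => (k : nat).
apply: (@leq_bigmax_cond _ _ F (Ordinal ltC)) => /=.
apply/existsP; exists [ffun v => enum_rank (f v)]; apply/andP; split.
  apply/forallP=> u; apply/forallP=> v; apply/implyP=> uv; rewrite !ffunE.
  rewrite (inj_eq enum_rank_inj).
  by move/forallP/(_ u)/forallP/(_ v)/implyP: pf; apply.
apply/forallP=> c1; apply/forallP=> c2; apply/implyP=> c12.
move/forallP/(_ (enum_val c1))/forallP/(_ (enum_val c2))/implyP: cf.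
rewrite (inj_eq enum_val_inj) => /(_ c12).
case/existsP=> u /existsP[v /and3P[uv /eqP fu /eqP fv]].
apply/existsP; exists u; apply/existsP; exists v.
by rewrite uv !ffunE fu fv !enum_valK !eqxx.
Qed.

Lemma achr_attained (G : sgraph) :
  0 < achr G -> exists f : G -> 'I_(achr G), achr_colouring f.
Proof.
pose P (k : 'I_#|G|.+1) := [exists f : {ffun G -> 'I_k}, achr_colouring f].
rewrite /achr -/P; case: (pickP P) => [k Pk _ | P0]; last first.
  by rewrite big_pred0.
have P_gt0 : 0 < #|P| by apply/card_gt0P; exists k.
have [k0 Pk0 ->] := eq_bigmax_cond (@nat_of_ord _) P_gt0.
by have /existsP[f achr_f] : P k0 := Pk0; exists f.
Qed.

(* Main.v *)
Require Import Defs.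
From mathcomp Require Import all_boot.

(** Each bound is witnessed by an explicit proper complete colouring, given by
    the p x q matrix of its colours.  Both conditions are decidable on the
    matrix, hence verified by evaluation.

    The witnesses come from a computer search restricted to colourings whose
    set of colour classes is invariant under a symmetry of the board: for
    q = 4 and q = 8 the permutation (0 1 2)(3 4 5) of the rows combined with
    (0 1 2) on the columns, for q = 6 the map (i, j) |-> (j, s i) with
    s = (0 1 2 3)(4 5). *)

Definition entry (M : seq (seq nat)) (i j : nat) : nat := nth 0 (nth [::] M i) j.

Definition cells (p q : nat) : seq (nat * nat) :=
  [seq (i, j) | i <- iota 0 p, j <- iota 0 q].

Definition cell_adj (u v : nat * nat) : bool :=
  ((u.1 == v.1) && (u.2 != v.2)) || ((u.1 != v.1) && (u.2 == v.2)).

(** Lists of naturals replace ordinals because quantifiers over a [finType] are locked and do not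
    reduce under [vm_compute]. *)
Definition achr_matrix (p q k : nat) (M : seq (seq nat)) : bool :=
  let f u := entry M u.1 u.2 in
  [&& all (fun u => f u < k) (cells p q),
      all (fun u => all (fun v => cell_adj u v ==> (f u != f v)) (cells p q))
        (cells p q)
    & all (fun c1 => all (fun c2 => (c1 != c2) ==>
        has (fun u => (f u == c1) &&
          has (fun v => cell_adj u v && (f v == c2)) (cells p q)) (cells p q))
        (iota 0 k)) (iota 0 k)].

Lemma mem_cells (p q : nat) (u : nat * nat) :
  (u \in cells p q) = (u.1 < p) && (u.2 < q).
Proof.
apply/allpairsP/andP => [[[i j] /= []] | [ltp ltq]].
  by rewrite !mem_iota => ? ? ->.
by exists u; rewrite !mem_iota /= ltp ltq; split=> //; case: u {ltp ltq}.
Qed.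

Lemma achr_matrix_leq (p q k : nat) (M : seq (seq nat)) :
  0 < p * q -> achr_matrix p q k M -> k <= achr (cart (K p) (K q)).
Proof.
(* The bound is trivial for no colours; otherwise [inord] into ['I_k.+1] is available, and [ltM]
   keeps it off its default value. *)
case: k => // k pq_gt0 /and3P[/allP ltM /allP properM /allP completeM].
pose cell (u : cart (K p) (K q)) : nat * nat := (val u.1, val u.2).
have cellP u : cell u \in cells p q by rewrite mem_cells /= !ltn_ord.
(* By conversion, since equality in ['I_n] is equality of the underlying naturals. *)
have adjE u v : adj u v = cell_adj (cell u) (cell v) by [].
pose col u := entry M (cell u).1 (cell u).2.
pose f u : 'I_k.+1 := inord (col u).
have fE u : f u = col u :> nat by rewrite inordK ?ltM.
have cell_surj x : x \in cells p q -> exists u, cell u = x.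
  case: x => i j; rewrite mem_cells /= => /andP[ltp ltq].
  by exists (Ordinal ltp, Ordinal ltq).
rewrite -[leqLHS]card_ord; apply: (@achr_max _ _ f).
  by rewrite card_prod !card_ord.
apply/andP; split.
  apply/forallP=> u; apply/forallP=> v; rewrite adjE -val_eqE /= !fE.
  by have /allP := properM _ (cellP u); apply.
apply/forallP=> c1; apply/forallP=> c2; apply/implyP=> c12.
have c_iota (c : 'I_k.+1) : (c : nat) \in iota 0 k.+1 by rewrite mem_iota /=.
have /allP/(_ _ (c_iota c2)) := completeM _ (c_iota c1).
rewrite val_eqE c12 => /hasP[x /cell_surj[u <-] /andP[/eqP fu]].
case/hasP=> y /cell_surj[v <-] /andP[uv /eqP fv].
apply/existsP; exists u; apply/existsP; exists v.
by rewrite adjE uv -!val_eqE /= !fE /col fu fv !eqxx.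
Qed.

Definition matrix_6_4 : seq (seq nat) :=
  [:: [:: 11;  6;  4;  3];
      [::  5;  9;  7;  4];
      [::  8;  3; 10;  5];
      [::  9;  1;  8;  2];
      [::  6; 10;  2;  0];
      [::  0;  7; 11;  1]].

Definition matrix_6_6 : seq (seq nat) :=
  [:: [::  2;  3; 11; 16;  8; 10];
      [:: 10;  4;  5; 13; 12;  2];
      [:: 15; 12;  6;  7;  4; 14];
      [::  9; 17; 14;  8; 16;  6];
      [:: 17;  9; 13;  5;  0;  1];
      [::  7; 11;  3; 15;  1;  0]].

(** As in [matrix_6_4], the symmetry cycles the colours 3m, 3m + 1, 3m + 2. Here 3, 4, 5, 9, 10, 11
    occur three times, all others twice. *)
Definition matrix_6_8 : seq (seq nat) :=
  [:: [:: 17; 18;  4;  1; 12;  3;  8;  5];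
      [::  5; 15; 19;  2; 13;  4;  6;  3];
      [:: 20;  3; 16;  0; 14;  5;  7;  4];
      [:: 13;  8;  0; 16; 10;  9; 18; 11];
      [::  1; 14;  6; 17; 11; 10; 19;  9];
      [::  7;  2; 12; 15;  9; 11; 20; 10]].

Theorem proposition4 :
  [/\ achr (cart (K 6) (K 4)) >= 12,
      achr (cart (K 6) (K 6)) >= 18
    & achr (cart (K 6) (K 8)) >= 21].
Proof.
split.
- by apply: (@achr_matrix_leq _ _ _ matrix_6_4) => //; vm_compute.
- by apply: (@achr_matrix_leq _ _ _ matrix_6_6) => //; vm_compute.
- by apply: (@achr_matrix_leq _ _ _ matrix_6_8) => //; vm_compute.
Qed.
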